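(* For all integers $n\geq 0$, $$S(64n+43) \equiv S(16n+11) \pmod{8}\qquad\text{and}\qquad S(64n+59) \equiv S(16n+15) \pmod{8}.$$
   Context: For $|q|<1$ (or as formal power series in $q$), let $(a;q)_\infty:=\prod_{k\geq 0}(1-aq^k)$. The function $S(n)$ (the number of overpartitions of $n$ of Schur-type, in the sense of Broudy and Lovejoy) is defined by the generating function $$\sum_{n=0}^{\infty} S(n)q^n = \frac{1}{(q;q^6)_\infty(q^5;q^6)_\infty(q^6;q^6)_\infty}.$$ *)

(* Defs.v *)
From mathcomp Require Import all_boot all_order all_algebra.

Set Implicit Arguments.
Unset Strict Implicit.
Unset Printing Implicit Defensive.

Import GRing.Theory.
Local Open Scope ring_scope.

(* Formal power series over the integers, as coefficient sequences. *)
Definition fps := nat -> int.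

Definition fps1 : fps := fun n => (n == 0%N)%:R.

Definition fps_mul (f g : fps) : fps :=
  fun n => \sum_(i < n.+1) f i * g (n - i)%N.

(* The first n coefficients g_0, ..., g_{n-1} of 1/f, determined one after the
   other by f_0 g_n + f_1 g_{n-1} + ... + f_n g_0 = [n = 0]. *)
Fixpoint fps_inv_seq (f : fps) (n : nat) : seq int :=
  if n is m.+1 then
    let s := fps_inv_seq f m in
    rcons s ((f 0%N)^-1 * ((m == 0%N)%:R - \sum_(i < m) f (m - i)%N * s`_i))
  else [::].

(* Meaningful when the constant term of f is a unit, see [fps_mulV]. *)
Definition fps_inv (f : fps) : fps := fun n => (fps_inv_seq f n.+1)`_n.

Definition fps_cvg (u : nat -> fps) (f : fps) : Prop :=
  forall n, exists N, forall m, (N <= m)%N -> u m n = f n.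

Definition qpoch_part (a q : {poly int}) (N : nat) : {poly int} :=
  \prod_(k < N) (1 - a * q ^+ k).

(* (a; q)_oo, for q without constant term: the coefficient of 'X^n in the
   partial products no longer changes from N = n.+1 on, see [qpoch_cvg]. *)
Definition qpoch (a q : {poly int}) : fps :=
  fun n => (qpoch_part a q n.+1)`_n.

Definition schurS : fps :=
  fps_inv (fps_mul (fps_mul (qpoch 'X 'X^6) (qpoch 'X^5 'X^6))
                   (qpoch 'X^6 'X^6)).

Lemma size_fps_inv_seq f n : size (fps_inv_seq f n) = n.
Proof. by elim: n => //= n IHn; rewrite size_rcons IHn. Qed.

Lemma nth_fps_inv_seq f n i : (i < n)%N -> (fps_inv_seq f n)`_i = fps_inv f i.
Proof.
elim: n => // n IHn; rewrite ltnS leq_eqVlt => /predU1P[-> // | lt_in].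
by rewrite /= nth_rcons size_fps_inv_seq lt_in IHn.
Qed.

Lemma fps_invE f n :
  fps_inv f n =
    (f 0%N)^-1 * ((n == 0%N)%:R - \sum_(i < n) f (n - i)%N * fps_inv f i).
Proof.
rewrite {1}/fps_inv /= nth_rcons size_fps_inv_seq ltnn eqxx.
by congr (_ * (_ - _)); apply: eq_bigr => i _; rewrite nth_fps_inv_seq.
Qed.

Lemma fps_mulV (f : fps) :
  f 0%N \is a GRing.unit -> fps_mul f (fps_inv f) =1 fps1.
Proof.
move=> f0 n; rewrite /fps_mul (reindex_inj rev_ord_inj) big_ord_recr /=.
rewrite subnn subn0 [fps_inv f n]fps_invE mulVKr //.
rewrite (eq_bigr (fun i : 'I_n => f (n - i)%N * fps_inv f i)); last first.
  by move=> i _; rewrite subSS subKn // ltnW.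
by rewrite addrC subrK.
Qed.

Lemma qpoch_cvg (a q : {poly int}) : q`_0 = 0 ->
  fps_cvg (fun N => fun n => (qpoch_part a q N)`_n) (qpoch a q).
Proof.
move=> q0 n; exists n.+1 => m; elim: m => // m IHm.
rewrite leq_eqVlt => /predU1P[<- // | lt_nm]; rewrite -IHm //.
have /factor_theorem[r ->] : root q 0 by rewrite /root horner_coef0 q0.
rewrite /qpoch_part big_ord_recr /= subr0 mulrBr mulr1 coefB exprMn !mulrA.
by rewrite coefMXn ifT ?subr0.
Qed.

Lemma schurSP :
  fps_mul (fps_mul (fps_mul (qpoch 'X 'X^6) (qpoch 'X^5 'X^6))
                   (qpoch 'X^6 'X^6)) schurS =1 fps1.
Proof.
apply: fps_mulV; rewrite /fps_mul !big_ord1 /qpoch /qpoch_part !big_ord1.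
by rewrite !expr0 !mulr1 !coefB !coef1 coefX !coefXn.
Qed.

(* Main.v *)
Require Import Defs.
From mathcomp Require Import all_boot all_order all_algebra.
From mathcomp Require Import zify ring.

(** By the Jacobi triple product, with [s = sum S(n) q^(3n)] we have [s psi = q]
    for [psi = sum_(m = 1 mod 3) (-1)^(m+1) q^(m^2) = A - B], where [A] and [B]
    collect the odd and the even [m].  Put [P = A + B], so that [B = P(q^4)], and
    [Phi = sum_k (-1)^k q^(9k^2)], [F = sum_k q^(9k^2)].  Isometries of the
    Hurwitz lattice give the quartic identity
      [A^4 - B^4 = psi(q^4) Phi(q^4)^3].
    As the exponents of [A] are 1 mod 4 and those of [B] are 0 mod 4, the terms
    of exponent 1 mod 4 in [s = q (A^3 + A^2 B + A B^2 + B^3) / (A^4 - B^4)] are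
      [sum_N s_(4N+1) q^N = P^3 / (psi Phi^3) = Phi (A^2 + 4 A B + 7 B^2) mod 8],
    because [Phi^4 = 1 mod 8] and [P = psi + 2 B].  Let [w_M] be the coefficients
    of [P^2 F].  Sorting exponents mod 4, this series has coefficient [7 w_M] at
    [N = 4M] and [- w_N] at [N = 3 mod 4], while [w_(4M) = w_M].  Both congruences
    follow, since [3 (64n + 43) = 64 (3n + 2) + 1] and
    [3 (64n + 59) = 16 (12n + 11) + 1]. *)

Set Implicit Arguments.
Unset Strict Implicit.
Unset Printing Implicit Defensive.

Import Order.TTheory GRing.Theory Num.Theory.
Local Open Scope ring_scope.

(** * Congruences of integer polynomials modulo [(c, 'X^K)] *)

(* Congruence modulo the ideal (c, X^K); power series identities are the case
   c = 0 for every K. *)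
Definition eqmX (c : int) (K : nat) (p q : {poly int}) : Prop :=
  exists u v, p = q + c%:P * u + 'X^K * v.

Lemma eqmX_refl c K p : eqmX c K p p.
Proof. by exists 0, 0; rewrite !mulr0 !addr0. Qed.

Lemma eqmX_eq c K p q : p = q -> eqmX c K p q.
Proof. by move=> ->; apply: eqmX_refl. Qed.

Lemma eqmX_sym c K p q : eqmX c K p q -> eqmX c K q p.
Proof. by move=> [u [v ->]]; exists (- u), (- v); ring. Qed.

Lemma eqmX_trans c K q p r : eqmX c K p q -> eqmX c K q r -> eqmX c K p r.
Proof. by move=> [u [v ->]] [u' [v' ->]]; exists (u + u'), (v + v'); ring. Qed.

Lemma eqmXD c K p q p' q' :
  eqmX c K p q -> eqmX c K p' q' -> eqmX c K (p + p') (q + q').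
Proof. by move=> [u [v ->]] [u' [v' ->]]; exists (u + u'), (v + v'); ring. Qed.

Lemma eqmXM c K p q p' q' :
  eqmX c K p q -> eqmX c K p' q' -> eqmX c K (p * p') (q * q').
Proof.
move=> [u [v ->]] [u' [v' ->]].
exists (u * q' + q * u' + c%:P * u * u'),
  (v * q' + q * v' + c%:P * u * v' + c%:P * v * u' + 'X^K * v * v'); ring.
Qed.

Lemma eqmXN c K p q : eqmX c K p q -> eqmX c K (- p) (- q).
Proof. by move=> [u [v ->]]; exists (- u), (- v); ring. Qed.

Lemma eqmXX c K p q n : eqmX c K p q -> eqmX c K (p ^+ n) (q ^+ n).
Proof.
move=> epq; elim: n => [|n IHn]; first exact: eqmX_refl.
by rewrite !exprS; apply: eqmXM.
Qed.

Lemma eqmX_le c K K' p q : (K' <= K)%N -> eqmX c K p q -> eqmX c K' p q.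
Proof.
move=> leK [u [v ->]]; exists u, ('X^(K - K') * v).
by rewrite mulrA -exprD subnKC.
Qed.

Lemma eqmX_weak c K p q : eqmX 0 K p q -> eqmX c K p q.
Proof. by move=> [u [v ->]]; exists 0, v; rewrite polyC0; ring. Qed.

Lemma eqmX_coef c K p q i :
  eqmX c K p q -> (i < K)%N -> exists z, p`_i = q`_i + c * z.
Proof.
move=> [u [v ->]] iK; exists u`_i.
by rewrite !coefD coefCM coefXnM iK addr0.
Qed.

Lemma eqmX0_coef K p q i : eqmX 0 K p q -> (i < K)%N -> p`_i = q`_i.
Proof. by move=> epq /(eqmX_coef epq)[z ->]; rewrite mul0r addr0. Qed.

Lemma eqmX_coefP c K (p q : {poly int}) :
  (forall i, (i < K)%N -> p`_i = q`_i) -> eqmX c K p q.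
Proof.
move=> epq; exists 0, (drop_poly K (p - q)).
have tk0 : take_poly K (p - q) = 0.
  apply/polyP => i; rewrite coef_take_poly coefB coef0.
  by case: ltnP => // /epq ->; rewrite subrr.
by rewrite mulr0 addr0 mulrC -[_ * _]add0r -tk0 poly_take_drop addrC subrK.
Qed.

Lemma eqmX_comp_Xn c K n p q :
  eqmX c K p q -> eqmX c (n * K) (p \Po 'X^n) (q \Po 'X^n).
Proof.
move=> [u [v ->]]; exists (u \Po 'X^n), (v \Po 'X^n).
by rewrite !comp_polyD !comp_polyM comp_polyC comp_Xn_poly exprM.
Qed.

Lemma eqmX_mulXnl c K n (p q : {poly int}) :
  eqmX c (n + K) ('X^n * p) ('X^n * q) -> eqmX c K p q.
Proof.
move=> [u [v e]]; exists (drop_poly n u), v.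
have shift (r : {poly int}) i : ('X^n * r)`_(n + i) = r`_i.
  by rewrite coefXnM ltnNge leq_addr addKn.
apply/polyP => i; rewrite -(shift p) e exprD -mulrA !coefD !shift !coefCM.
by rewrite coef_drop_poly (addnC n i).
Qed.

(** * Finite theta sums and their reindexing *)

Definition theta (I : Type) (L : seq I) (s : I -> int) (w : I -> nat) : {poly int} :=
  \sum_(x <- L) (s x)%:P * 'X^(w x).

Lemma theta_filter I (L : seq I) (a : pred I) s w :
  theta L s w = theta (filter a L) s w + theta (filter (predC a) L) s w.
Proof. by rewrite /theta !big_filter (bigID a). Qed.

Lemma eq_in_theta (I : eqType) (L : seq I) s s' w :
  {in L, s =1 s'} -> theta L s w = theta L s' w.
Proof. by move=> es; apply: eq_big_seq => x /es ->. Qed.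

Lemma thetaN I (L : seq I) s w : theta L (fun x => - s x) w = - theta L s w.
Proof. by rewrite /theta -sumrN; apply: eq_bigr => x _; rewrite polyCN mulNr. Qed.

Lemma thetaM I J (L : seq I) (L' : seq J) s s' w w' :
  theta L s w * theta L' s' w' =
  theta [seq (x, y) | x <- L, y <- L']
    (fun p => s p.1 * s' p.2) (fun p => (w p.1 + w' p.2)%N).
Proof.
rewrite /theta big_allpairs big_distrlr; apply: eq_bigr => x _.
by apply: eq_bigr => y _; rewrite /= polyCM exprD; ring.
Qed.

Lemma theta_comp_Xn I (L : seq I) s w n :
  theta L s w \Po 'X^n = theta L s (fun x => (n * w x)%N).
Proof.
rewrite /theta raddf_sum; apply: eq_bigr => x _ /=.
by rewrite comp_polyM comp_polyC comp_Xn_poly exprM.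
Qed.

Lemma coef_theta I (L : seq I) s w i :
  (theta L s w)`_i = \sum_(x <- L | w x == i) s x.
Proof.
rewrite /theta coef_sum [RHS]big_mkcond; apply: eq_bigr => x _ /=.
by rewrite coefCM coefXn eq_sym; case: eqP; rewrite ?mulr1 ?mulr0.
Qed.

(* Only the terms of weight below K need to be matched, which frees the
   bijections of any boundary conditions on the finite ranges L and L'. *)
Lemma theta_reindex c K (I J : eqType) (L : seq I) (L' : seq J)
    (h : I -> J) (h' : J -> I) s s' w w' :
  uniq L -> uniq L' ->
  (forall x, x \in L -> (w x < K)%N ->
     [/\ h x \in L', w' (h x) = w x, s' (h x) = s x & h' (h x) = x]) ->
  (forall y, y \in L' -> (w' y < K)%N ->
     [/\ h' y \in L, w (h' y) = w' y & h (h' y) = y]) ->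
  eqmX c K (theta L s w) (theta L' s' w').
Proof.
move=> uL uL' hP h'P; apply: eqmX_coefP => i iK.
rewrite !coef_theta -big_filter -[RHS]big_filter.
rewrite [RHS](@perm_big _ _ _ _ _ (map h [seq x <- L | w x == i])) ?big_map.
  apply: eq_big_seq => x; rewrite mem_filter => /andP[/eqP wx xL].
  by case: (hP x xL); rewrite ?wx.
apply: uniq_perm; rewrite ?filter_uniq //.
  rewrite map_inj_in_uniq ?filter_uniq // => x y.
  rewrite !mem_filter => /andP[/eqP wx xL] /andP[/eqP wy yL] e.
  case: (hP x xL); rewrite ?wx // => _ _ _ <-.
  by case: (hP y yL); rewrite ?wy // => _ _ _ <-; rewrite e.
move=> y; rewrite mem_filter; apply/andP/mapP => [[/eqP wy yL]|[x]].
  case: (h'P y yL); rewrite ?wy // => xL wx e; exists (h' y) => //.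
  by rewrite mem_filter wx eqxx.
rewrite mem_filter => /andP[/eqP wx xL] ->.
by case: (hP x xL); rewrite ?wx // => hL ->.
Qed.

Lemma mem_pairs (I J : eqType) (L : seq I) (L' : seq J) p :
  (p \in [seq (x, y) | x <- L, y <- L']) = (p.1 \in L) && (p.2 \in L').
Proof.
case: p => x y; apply/allpairsP/andP => [[[a b] [/= ? ? [-> ->]]] //|[? ?]].
by exists (x, y).
Qed.

Lemma uniq_pairs (I J : eqType) (L : seq I) (L' : seq J) :
  uniq L -> uniq L' -> uniq [seq (x, y) | x <- L, y <- L'].
Proof. by move=> uL uL'; apply: allpairs_uniq => // -[? ?] [? ?] _ _. Qed.

(** * Integers sorted by residues mod 3 and mod 2, and their signs *)

Definition sq (m : int) : nat := (`|m| ^ 2)%N.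

Definition zrange (K : nat) : seq int :=
  [seq i%:Z - K%:Z | i <- iota 0 (2 * K).+1].

Definition zres (K : nat) (r : int) : seq int :=
  [seq m <- zrange K | (m %% 3)%Z == r].

Definition zpar (K : nat) (r b : int) : seq int :=
  [seq m <- zres K r | (m %% 2)%Z == b].

Definition sgn (m : int) : int := if (m %% 2)%Z == 0 then 1 else -1.

(** On even [m] this is [(-1)^(m/2)], the sign that [sgn] becomes under [m -> - 2 * m]. *)
Definition sgn4 (m : int) : int := if (m %% 4)%Z == 0 then 1 else -1.

Lemma mem_zrange K m : (m \in zrange K) = (`|m| <= K)%N.
Proof.
apply/mapP/idP => [[i]|mK]; first by rewrite mem_iota => ? ->; lia.
by exists (absz (m + K%:Z)); rewrite ?mem_iota; lia.
Qed.

Lemma mem_zres K r m : (m \in zres K r) = ((m %% 3)%Z == r) && (`|m| <= K)%N.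
Proof. by rewrite mem_filter mem_zrange. Qed.

Lemma mem_zpar K r b m :
  (m \in zpar K r b) = [&& (m %% 2)%Z == b, (m %% 3)%Z == r & (`|m| <= K)%N].
Proof. by rewrite mem_filter mem_zres. Qed.

Lemma uniq_zres K r : uniq (zres K r).
Proof.
by rewrite filter_uniq // map_inj_uniq ?iota_uniq // => i j /addIr[].
Qed.

Lemma uniq_zpar K r b : uniq (zpar K r b).
Proof. by rewrite filter_uniq // uniq_zres. Qed.

Lemma sqE m : (sq m)%:Z = m ^+ 2.
Proof. by rewrite /sq; lia. Qed.

Lemma sq_le K m n : (sq m + n < K)%N -> (`|m| <= K)%N.
Proof. by rewrite /sq => h; have := leq_addr n (`|m| ^ 2); nia. Qed.

(** * Isometries of quadruples and the quartic identity *)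

Definition quad : Type := int * int * int * int.

Definition quads (L1 L2 : seq int) : seq quad :=
  [seq (x, y) | x <- [seq (x, y) | x <- [seq (x, y) | x <- L1, y <- L2],
                                   y <- L2],
                y <- L2].

Definition qnorm (v : quad) : nat :=
  (sq v.1.1.1 + sq v.1.1.2 + sq v.1.2 + sq v.2)%N.

Lemma mem_quads L1 L2 a b c d :
  ((a, b, c, d) \in quads L1 L2) =
    [&& a \in L1, b \in L2, c \in L2 & d \in L2].
Proof. by rewrite !mem_pairs /= -!andbA. Qed.

Lemma uniq_quads L1 L2 : uniq L1 -> uniq L2 -> uniq (quads L1 L2).
Proof. by move=> u1 u2; rewrite !uniq_pairs. Qed.

Lemma thetaM4 L1 L2 s1 s2 :
  theta L1 s1 sq * theta L2 s2 sq ^+ 3 =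
  theta (quads L1 L2)
    (fun v => s1 v.1.1.1 * s2 v.1.1.2 * s2 v.1.2 * s2 v.2) qnorm.
Proof. by rewrite !exprS expr0 mulr1 !mulrA !thetaM. Qed.

Lemma qnorm_le K a b c d : (qnorm (a, b, c, d) < K)%N ->
  [/\ `|a| <= K, `|b| <= K, `|c| <= K & `|d| <= K]%N.
Proof.
rewrite /qnorm /= => h; split.
- by apply: (@sq_le _ _ (sq b + sq c + sq d)%N); lia.
- by apply: (@sq_le _ _ (sq a + sq c + sq d)%N); lia.
- by apply: (@sq_le _ _ (sq a + sq b + sq d)%N); lia.
- by apply: (@sq_le _ _ (sq a + sq b + sq c)%N); lia.
Qed.

Lemma qnorm_eq (a b c d x y z t : int) :
  a ^+ 2 + b ^+ 2 + c ^+ 2 + d ^+ 2 = x ^+ 2 + y ^+ 2 + z ^+ 2 + t ^+ 2 ->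
  qnorm (a, b, c, d) = qnorm (x, y, z, t).
Proof.
by move=> e; apply/eqP; rewrite -eqz_nat /qnorm /= !PoszD !sqE e.
Qed.

(* Vectors of Z^4 with all entries of one parity form twice the Hurwitz lattice.
   refl4 is minus the reflection in (1,1,1,1): it fixes (1,1,1,1) mod 3 and, when
   half the coordinate sum is odd, exchanges the all odd and all even vectors. *)
Definition refl4 (v : quad) : quad :=
  let: (a, b, c, d) := v in
  let e := ((a + b + c + d) %/ 2)%Z in (e - a, e - b, e - c, e - d).

(* An orthogonal involution that swaps the classes (1,0,0,0) and (1,1,1,1) mod 3;
   halves are exact on vectors with entries of one parity. *)
Definition hadamard (v : quad) : quad :=
  let: (a, b, c, d) := v in
  ((- (a + b + c + d)) %/ 2, (- (a + b - c - d)) %/ 2,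
   (- (a - b + c - d)) %/ 2, (- (a - b - c + d)) %/ 2)%Z.

(** For an even coordinate sum this asks whether the half sum is even. Vectors that satisfy it are
    treated by [hadamard], the other ones by [refl4]. *)
Definition ev4 (v : quad) : bool :=
  let: (a, b, c, d) := v in ((a + b + c + d) %% 4)%Z == 0.

Lemma refl4P (a b c d : int) : ((a + b + c + d) %% 2)%Z = 0 ->
  [/\ qnorm (refl4 (a, b, c, d)) = qnorm (a, b, c, d) &
      exists2 e, a + b + c + d = 2 * e &
      refl4 (a, b, c, d) = (e - a, e - b, e - c, e - d)].
Proof.
move=> e0; set e := ((a + b + c + d) %/ 2)%Z.
have e2 : a + b + c + d = 2 * e by lia.
split; last by exists e.
apply: qnorm_eq; rewrite -/e; have -> : d = 2 * e - a - b - c by lia.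
by ring.
Qed.

Lemma hadamardP (a b c d : int) :
  (a %% 2 = b %% 2)%Z -> (a %% 2 = c %% 2)%Z -> (a %% 2 = d %% 2)%Z ->
  [/\ qnorm (hadamard (a, b, c, d)) = qnorm (a, b, c, d) &
      exists x y z t, [/\ hadamard (a, b, c, d) = (x, y, z, t),
        2 * x = - (a + b + c + d), 2 * y = - (a + b - c - d),
        2 * z = - (a - b + c - d) & 2 * t = - (a - b - c + d)]].
Proof.
move=> ab ac ad; rewrite /hadamard.
set x := (_ %/ 2)%Z; set y := (_ %/ 2)%Z; set z := (_ %/ 2)%Z; set t := (_ %/ 2)%Z.
have ex : 2 * x = - (a + b + c + d) by rewrite /x; lia.
have ey : 2 * y = - (a + b - c - d) by rewrite /y; lia.
have ez : 2 * z = - (a - b + c - d) by rewrite /z; lia.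
have et : 2 * t = - (a - b - c + d) by rewrite /t; lia.
split; last by exists x, y, z, t.
apply: qnorm_eq; apply: (@mulfI _ (2 ^+ 2)) => //.
by rewrite !mulrDr -!exprMn ex ey ez et; ring.
Qed.

Lemma mem_parq K (p : pred quad) r b r' b' (x y z t : int) :
  reflect
    [/\ p (x, y, z, t),
        [/\ x %% 2 = b, y %% 2 = b', z %% 2 = b' & t %% 2 = b']%Z,
        [/\ x %% 3 = r, y %% 3 = r', z %% 3 = r' & t %% 3 = r']%Z &
        [/\ `|x| <= K, `|y| <= K, `|z| <= K & `|t| <= K]%N]
    ((x, y, z, t) \in filter p (quads (zpar K r b) (zpar K r' b'))).
Proof.
rewrite mem_filter mem_quads !mem_zpar; apply: (iffP idP).
  case/andP=> -> /and4P[/and3P[/eqP-> /eqP-> ->] /and3P[/eqP-> /eqP-> ->]].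
  by case/and3P=> /eqP-> /eqP-> -> /and3P[/eqP-> /eqP-> ->].
by case=> -> [-> -> -> ->] [-> -> -> ->] [-> -> -> ->]; rewrite !eqxx.
Qed.

(** Let [e] be half the coordinate sum. It is odd, so [e - x] has the parity opposite to [x]; and
    [2 e = 4] mod 3 gives [e = 2], so [e - x = 1] mod 3. The image has the same half sum
    [4 e / 2 - e = e], which makes the map an involution. *)
Lemma refl4_parq K b b' v : (b, b') = (0, 1) \/ (b, b') = (1, 0) ->
  v \in filter (predC ev4) (quads (zpar K 1 b) (zpar K 1 b)) ->
  (qnorm v < K)%N ->
  [/\ refl4 v \in filter (predC ev4) (quads (zpar K 1 b') (zpar K 1 b')),
      qnorm (refl4 v) = qnorm v & refl4 (refl4 v) = v].
Proof.
move=> eb; case: v => [[[x y] z] t].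
case/mem_parq=> /eqP ev [x2 y2 z2 t2] [x3 y3 z3 t3] _ nK; rewrite /= in ev.
have [|En [e Ee E]] := @refl4P x y z t; first by clear -x2 y2 z2 t2 eb; lia.
rewrite -En E in nK; have bd := qnorm_le nK; rewrite En E.
have [|_ [f Ef ->]] := @refl4P (e - x) (e - y) (e - z) (e - t).
  by clear -Ee; lia.
have ef : f = e by clear -Ee Ef; lia.
clear nK En Ef; split=> //; last by rewrite ef; congr (_, _, _, _); ring.
have e2 : (e %% 2)%Z = 1 by clear -Ee ev; lia.
have e3 : (e %% 3)%Z = 2 by clear -Ee x3 y3 z3 t3; lia.
have bb' : b' = 1 - b by clear -eb; case: eb => -[-> ->].
apply/mem_parq; split=> //=.
- by clear -Ee e2; lia.
- by clear -e2 x2 y2 z2 t2 bb' eb; split; lia.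
- by clear -e3 x3 y3 z3 t3; split; lia.
Qed.

Lemma theta_refl4 K :
  eqmX 0 K
    (theta (filter (predC ev4) (quads (zpar K 1 1) (zpar K 1 1))) (fun=> 1) qnorm)
    (theta (filter (predC ev4) (quads (zpar K 1 0) (zpar K 1 0))) (fun=> 1) qnorm).
Proof.
apply: (@theta_reindex _ _ _ _ _ _ refl4 refl4).
- by rewrite filter_uniq ?uniq_quads ?uniq_zpar.
- by rewrite filter_uniq ?uniq_quads ?uniq_zpar.
- by move=> v vL vK; case: (refl4_parq (or_intror erefl) vL vK).
- by move=> v vL vK; case: (refl4_parq (or_introl erefl) vL vK).
Qed.

Lemma hadamardK (a b c d : int) :
  (a %% 2 = b %% 2)%Z -> (a %% 2 = c %% 2)%Z -> (a %% 2 = d %% 2)%Z ->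
  hadamard (hadamard (a, b, c, d)) = (a, b, c, d).
Proof.
move=> ab ac ad.
have [_ [x [y [z [t [-> ex ey ez et]]]]]] := hadamardP ab ac ad.
have [|||_ [a' [b' [c' [d' [-> ? ? ? ?]]]]]] := @hadamardP x y z t.
- by clear -ex ey ab ac ad; lia.
- by clear -ex ez ab ac ad; lia.
- by clear -ex et ab ac ad; lia.
by clear ab ac ad; congr (_, _, _, _); lia.
Qed.

(** The first image entry is minus the half sum, so [ev4 v] decides its parity; the other entries
    differ from it by sums of two even numbers. Doubled, every entry is [-1] or [1 - 3] up to
    multiples of 3, hence is 1 mod 3. The image entries add up to [- 2 * x] with [x] even, which
    gives [ev4]. *)
Lemma hadamard_to K b v : b = 0 \/ b = 1 ->
  v \in filter (fun v => ev4 v == (b == 0)) (quads (zpar K 1 0) (zpar K 0 0)) ->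
  (qnorm v < K)%N ->
  [/\ hadamard v \in filter ev4 (quads (zpar K 1 b) (zpar K 1 b)),
      qnorm (hadamard v) = qnorm v & hadamard (hadamard v) = v].
Proof.
move=> hb; case: v => [[[x y] z] t].
case/mem_parq=> /eqP ev [x2 y2 z2 t2] [x3 y3 z3 t3] _ nK; rewrite /= in ev.
have xy : (x %% 2 = y %% 2)%Z by rewrite x2 y2.
have xz : (x %% 2 = z %% 2)%Z by rewrite x2 z2.
have xt : (x %% 2 = t %% 2)%Z by rewrite x2 t2.
rewrite (hadamardK xy xz xt).
have [En [a [b' [c [d [E ea eb ec ed]]]]]] := hadamardP xy xz xt.
rewrite -En E in nK; have bd := qnorm_le nK; rewrite En E.
split=> //; apply/mem_parq; split=> //=;
  clear -hb ev x2 y2 z2 t2 x3 y3 z3 t3 ea eb ec ed.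
- have -> : a + b' + c + d = - 2 * x by clear -ea eb ec ed; lia.
  by clear -x2; lia.
- have ab : (a %% 2)%Z = b by clear eb ec ed x3 y3 z3 t3; lia.
  by clear hb ev x3 y3 z3 t3; split; lia.
- by clear hb ev x2 y2 z2 t2; split; lia.
Qed.

(** Mod 3, the doubled entries are [-4] once and 0 three times, hence the class (1,0,0,0). The first
    entry is minus an even half sum and the others have its parity. The image entries add up to
    [- 2 * x], so [ev4] of the image reads off the parity [b] of [x]. *)
Lemma hadamard_of K b v : b = 0 \/ b = 1 ->
  v \in filter ev4 (quads (zpar K 1 b) (zpar K 1 b)) -> (qnorm v < K)%N ->
  [/\ hadamard v \in
        filter (fun v => ev4 v == (b == 0)) (quads (zpar K 1 0) (zpar K 0 0)),
      qnorm (hadamard v) = qnorm v & hadamard (hadamard v) = v].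
Proof.
move=> hb; case: v => [[[x y] z] t].
case/mem_parq=> /eqP ev [x2 y2 z2 t2] [x3 y3 z3 t3] _ nK; rewrite /= in ev.
have xy : (x %% 2 = y %% 2)%Z by rewrite x2 y2.
have xz : (x %% 2 = z %% 2)%Z by rewrite x2 z2.
have xt : (x %% 2 = t %% 2)%Z by rewrite x2 t2.
rewrite (hadamardK xy xz xt).
have [En [a [b' [c [d [E ea eb ec ed]]]]]] := hadamardP xy xz xt.
rewrite -En E in nK; have bd := qnorm_le nK; rewrite En E.
split=> //; apply/mem_parq; split=> //=;
  clear -hb ev x2 y2 z2 t2 x3 y3 z3 t3 ea eb ec ed.
- have -> : a + b' + c + d = - 2 * x by clear -ea eb ec ed; lia.
  by apply/eqP; clear -hb x2; case: hb => e; rewrite {}e in x2 *; lia.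
- have a2 : (a %% 2)%Z = 0 by clear -ev ea; lia.
  by clear ev x3 y3 z3 t3; split; lia.
- by clear hb ev x2 y2 z2 t2; split; lia.
Qed.

Lemma theta_hadamard K b (s : quad -> int) : b = 0 \/ b = 1 ->
  {in filter (fun v => ev4 v == (b == 0)) (quads (zpar K 1 0) (zpar K 0 0)),
    s =1 fun=> 1} ->
  eqmX 0 K
    (theta (filter (fun v => ev4 v == (b == 0)) (quads (zpar K 1 0) (zpar K 0 0)))
       s qnorm)
    (theta (filter ev4 (quads (zpar K 1 b) (zpar K 1 b))) (fun=> 1) qnorm).
Proof.
move=> hb s1; apply: (@theta_reindex _ _ _ _ _ _ hadamard hadamard).
- by rewrite filter_uniq ?uniq_quads ?uniq_zpar.
- by rewrite filter_uniq ?uniq_quads ?uniq_zpar.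
- by move=> v vL vK; case: (hadamard_to hb vL vK); rewrite s1.
- by move=> v vL vK; case: (hadamard_of hb vL vK).
Qed.

(** Split all three sums by [ev4]. In the difference of fourth powers the parts outside [ev4] cancel
    through [refl4]. The remaining odd and even parts correspond under [hadamard] to the vectors on
    the right outside and inside [ev4], which carry the signs 1 and -1. *)
Lemma theta_quartic K :
  eqmX 0 K
    (theta (zpar K 1 1) (fun=> 1) sq ^+ 4 - theta (zpar K 1 0) (fun=> 1) sq ^+ 4)
    (theta (zpar K 1 0) (fun m => - sgn4 m) sq * theta (zpar K 0 0) sgn4 sq ^+ 3).
Proof.
rewrite [X in X - _]exprS [X in _ - X]exprS !thetaM4.
rewrite [X in X - _](theta_filter _ ev4) [X in _ - X](theta_filter _ ev4).
rewrite [X in eqmX _ _ _ X](theta_filter _ ev4).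
set s := fun v : quad => - sgn4 _ * _ * _ * _.
(* On even entries the product of the [sgn4] is -1 to the power of half the coordinate sum. *)
have s_ev v : v \in quads (zpar K 1 0) (zpar K 0 0) ->
    s v = if ev4 v then -1 else 1.
  case: v => [[[x y] z] t]; rewrite mem_quads !mem_zpar.
  case/and4P=> /andP[/eqP x2 _] /andP[/eqP y2 _] /andP[/eqP z2 _] /andP[/eqP t2 _].
  by rewrite /s /sgn4 /=; do 5![case: eqP => ?] => //=; lia.
have F0 : filter ev4 (quads (zpar K 1 0) (zpar K 0 0)) =
    filter (fun v => ev4 v == (0 == 0 :> int)) (quads (zpar K 1 0) (zpar K 0 0)).
  by apply: eq_filter => v /=; rewrite eqxx; case: (ev4 v).
have F1 : filter (predC ev4) (quads (zpar K 1 0) (zpar K 0 0)) =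
    filter (fun v => ev4 v == (1 == 0 :> int)) (quads (zpar K 1 0) (zpar K 0 0)).
  by apply: eq_filter => v /=; case: (ev4 v).
have H0 := @theta_hadamard K 0 (fun v => - s v) (or_introl erefl).
have H1 := @theta_hadamard K 1 s (or_intror erefl).
rewrite -F0 thetaN in H0; rewrite -F1 in H1.
have E1 := theta_refl4 K.
have {}H0 : eqmX 0 K (theta (filter ev4 (quads (zpar K 1 0) (zpar K 0 0))) s qnorm)
    (- theta (filter ev4 (quads (zpar K 1 0) (zpar K 1 0))) (fun=> 1) qnorm).
  rewrite -[X in eqmX _ _ X _]opprK; apply/eqmXN/H0 => v.
  by rewrite mem_filter => /andP[evv vL] /=; rewrite (s_ev _ vL) evv.
have {}H1 : eqmX 0 K
    (theta (filter (predC ev4) (quads (zpar K 1 0) (zpar K 0 0))) s qnorm)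
    (theta (filter ev4 (quads (zpar K 1 1) (zpar K 1 1))) (fun=> 1) qnorm).
  apply: H1 => v; rewrite mem_filter => /andP[evv vL].
  by rewrite (s_ev _ vL) (negbTE evv).
apply: eqmX_sym; apply: eqmX_trans (eqmXD H0 H1) _; apply: eqmX_sym.
have one L : theta L (fun _ : quad => 1 * 1 * 1 * 1) qnorm = theta L (fun=> 1) qnorm.
  by apply: eq_in_theta.
rewrite !one; have [u [v ->]] := E1; exists u, v; ring.
Qed.

(** * Gaussian binomials and the Jacobi triple product *)

(** The Pascal rule keeps the Gaussian binomial a polynomial without any division; [qbin_fact] links
    it to the quotient of q-factorials. *)
Fixpoint qbin (Q : {poly int}) (n k : nat) : {poly int} :=
  match n, k with
  | _, 0 => 1
  | 0, _.+1 => 0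
  | n'.+1, k'.+1 => qbin Q n' k' + Q ^+ k * qbin Q n' k
  end.

Definition qfact (Q : {poly int}) (n : nat) : {poly int} :=
  \prod_(i < n) (1 - Q ^+ i.+1).

Lemma qbinn0 Q n : qbin Q n 0 = 1.
Proof. by case: n. Qed.

Lemma qbin_small Q n k : (n < k)%N -> qbin Q n k = 0.
Proof.
elim: n k => [|n IHn] [|k] //= nk.
by rewrite !IHn ?mulr0 ?addr0 //; lia.
Qed.

Lemma qfactS Q n : qfact Q n.+1 = qfact Q n * (1 - Q ^+ n.+1).
Proof. by rewrite /qfact big_ord_recr. Qed.

Lemma qbin_fact Q n k : (k <= n)%N ->
  qbin Q n k * qfact Q k * qfact Q (n - k) = qfact Q n.
Proof.
elim: n k => [|n IHn] [|k] //.
- by rewrite /= /qfact big_ord0 !mulr1.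
- by rewrite subn0 /qfact big_ord0 /= !mul1r.
rewrite ltnS subSS /= => kn; have IHk := IHn _ kn.
have {IHk} -> : (qbin Q n k + Q ^+ k.+1 * qbin Q n k.+1) *
     qfact Q k.+1 * qfact Q (n - k)
   = qfact Q n * (1 - Q ^+ k.+1) +
     Q ^+ k.+1 * (qbin Q n k.+1 * qfact Q k.+1 * qfact Q (n - k)).
  by rewrite -IHk qfactS; ring.
case: (ltnP k n) => [lkn|nk].
  have -> : (n - k = (n - k.+1).+1)%N by lia.
  rewrite (qfactS _ (n - _)) !mulrA -(mulrA _ (qbin _ _ _)) -(mulrA (Q ^+ _)).
  rewrite (IHn _ lkn) qfactS.
  have -> : Q ^+ n.+1 = Q ^+ k.+1 * Q ^+ (n - k.+1).+1.
    by rewrite -exprD; congr (_ ^+ _); lia.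
  by ring.
have -> : k = n by lia.
by rewrite qbin_small // qfactS; ring.
Qed.

(** The q-binomial theorem, homogeneous in [x] and [y]. Removing the factor [k = 0] leaves the
    product for [x * Q], and multiplying its expansion by [y + x] reproduces the Pascal rule of
    [qbin]. *)
Lemma qbin_prod Q x y N :
  \prod_(k < N) (y + x * Q ^+ k) =
  \sum_(k < N.+1) Q ^+ 'C(k, 2) * qbin Q N k * x ^+ k * y ^+ (N - k).
Proof.
elim: N x => [|N IHN] x.
  by rewrite big_ord0 big_ord1 /= !mulr1.
rewrite big_ord_recl /= mulr1.
under eq_bigr do rewrite exprS mulrA.
rewrite IHN.
pose g k := Q ^+ 'C(k, 2) * qbin Q N k * (x * Q) ^+ k * y ^+ (N - k).
rewrite mulrDl [X in y * X](_ : _ = g 0%N + \sum_(k < N.+1) g k.+1); last first.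
  rewrite big_ord_recl -[X in _ = _ + X](big_mkord xpredT (fun k => g k.+1)).
  rewrite big_nat_recr //= big_mkord (_ : g N.+1 = 0) ?addr0 //.
  by rewrite /g qbin_small // mulr0 !mul0r.
rewrite [RHS]big_ord_recl /= mulrDr -addrA; congr (_ + _).
  by rewrite /g qbinn0 /= !mulr1 !subn0 exprS; ring.
rewrite !mulr_sumr -big_split; apply: eq_bigr => k _ /=.
rewrite /g /bump /= add1n subSS binS bin1 !exprD !exprMn.
have [kN|Nk] := ltnP k N.
  have -> : (N - k = (N - k.+1).+1)%N by lia.
  by rewrite !exprS; ring.
by rewrite qbin_small // exprS; ring.
Qed.

(** Writing [p = 1 - 'X * u], the inverse is the geometric sum in ['X * u], cut off with remainder
    ['X^K * u ^+ K]. *)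
Lemma eqmX_inv K (p : {poly int}) : p`_0 = 1 -> exists r, eqmX 0 K (p * r) 1.
Proof.
move=> p0; have /factor_theorem[u pu] : root (1 - p) 0.
  by rewrite /root horner_coef0 coefB coef1 p0 subrr.
have {pu}-> : p = 1 - 'X * u.
  by rewrite -[LHS](subKr 1) pu subr0 mulrC.
exists (\sum_(i < K) ('X * u) ^+ i), 0, (- u ^+ K).
have -> : 1 - 'X * u = - ('X * u - 1) by ring.
by rewrite mulNr -subrX1 exprMn polyC0; ring.
Qed.

Lemma qfact_coef0 n : (qfact 'X^6 n)`_0 = 1.
Proof.
elim: n => [|n IHn]; first by rewrite /qfact big_ord0 coef1.
by rewrite qfactS coef0M IHn mul1r coefB coef1 -exprM coefXn mulnS.
Qed.

Lemma qfact_eqmX n m : (n <= m)%N ->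
  eqmX 0 (6 * n.+1) (qfact 'X^6 m) (qfact 'X^6 n).
Proof.
elim: m => [|m IHm]; first by rewrite leqn0 => /eqP->; apply: eqmX_refl.
rewrite leq_eqVlt => /predU1P[-> |nm]; first exact: eqmX_refl.
apply: eqmX_trans (IHm nm).
exists 0, (- 'X^(6 * (m - n)) * qfact 'X^6 m).
rewrite qfactS -exprM; have -> : (6 * m.+1 = 6 * n.+1 + 6 * (m - n))%N by lia.
by rewrite exprD; ring.
Qed.

(** As [a] is at most [n], [k] and [2 * n - k], every q-factorial in [qbin_fact] agrees with
    [f = qfact 'X^6 a] to the given order. This yields [g * f * f = f], from which one [f] is
    cancelled with its inverse [r]. *)
Lemma qbin_eqmX n k a : (a <= k)%N -> (a + k <= 2 * n)%N -> (a <= n)%N ->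
  eqmX 0 (6 * a.+1) (qfact 'X^6 n * qbin 'X^6 (2 * n) k) 1.
Proof.
move=> ak akn an.
have [r er] := eqmX_inv (6 * a.+1) (qfact_coef0 a).
have kn : (k <= 2 * n)%N by lia.
have e1 := qbin_fact 'X^6 kn.
have ek := qfact_eqmX ak.
have e2n : eqmX 0 (6 * a.+1) (qfact 'X^6 (2 * n)) (qfact 'X^6 a).
  by apply: qfact_eqmX; lia.
have e2nk : eqmX 0 (6 * a.+1) (qfact 'X^6 (2 * n - k)) (qfact 'X^6 a).
  by apply: qfact_eqmX; lia.
have en := qfact_eqmX an.
set f := qfact 'X^6 a in er ek e2n e2nk en.
set g := qbin _ _ _ in e1 *.
have fgf : eqmX 0 (6 * a.+1) (g * f * f) f.
  apply: eqmX_trans e2n; rewrite -e1; apply: eqmX_sym.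
  by apply: eqmXM => //; apply: eqmXM => //; apply: eqmX_refl.
apply: eqmX_trans (eqmXM en (eqmX_refl _ _ g)) _.
have := eqmXM fgf (eqmX_refl 0 (6 * a.+1) r) => fgfr.
apply: eqmX_trans (eqmX_trans fgfr er).
have := eqmXM (eqmX_refl 0 (6 * a.+1) (f * g)) (eqmX_sym er).
by rewrite mulr1 => h; apply: eqmX_trans h _; apply: eqmX_eq; ring.
Qed.

(** With [j = k - n] this is the exponent [3 j^2 - 2 j] of the triple product. It is nonnegative at
    every integer [j], so [absz] only changes the type. *)
Definition jexp (n k : nat) : nat :=
  absz (3 * (k%:Z - n%:Z) ^+ 2 - 2 * (k%:Z - n%:Z))%R.

Lemma bin2Z n : 2 * ('C(n, 2))%:Z = n%:Z * (n%:Z - 1).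
Proof.
elim: n => [|n IHn] //; rewrite binS bin1 PoszD mulrDr IHn -natr1 natz; ring.
Qed.

Lemma jexpZ n k :
  (jexp n k)%:Z = 3 * (k%:Z - n%:Z) ^+ 2 - 2 * (k%:Z - n%:Z).
Proof. by rewrite /jexp gez0_abs //; nia. Qed.

Lemma jexpE n k : (k <= 2 * n)%N ->
  (6 * 'C(k, 2) + (6 * n - 1) * (2 * n - k) =
   6 * 'C(n, 2) + (6 * n - 1) * n + jexp n k)%N.
Proof.
move=> kn; have := bin2Z k; have := bin2Z n; have := jexpZ n k.
(* At [n = 0] the natural number [6 * n - 1] is 0 instead of -1, but there [k = 0] as well. *)
case: n kn => [|n] kn; first by have -> : k = 0%N by lia.
by rewrite !expr2; nia.
Qed.

(* Centring the q-binomial product at y = q^(6n-1) avoids negative powers. *)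
Lemma qprod_split n :
  \prod_(k < 2 * n) ('X^(6 * n - 1) + - 1 * 'X^6 ^+ k) =
  (-1) ^+ n * 'X^(6 * 'C(n, 2) + (6 * n - 1) * n) *
    (qpoch_part 'X 'X^6 n * qpoch_part 'X^5 'X^6 n) :> {poly int}.
Proof.
have prodc (x : {poly int}) : x ^+ n = \prod_(i < n) x.
  by rewrite prodr_const card_ord.
(* The index [n + i] gives [X^(6n-1) (1 - X^(6i+1))]. The lower half, read backwards at [n - i - 1],
   gives [- X^(6(n-i-1)) (1 - X^(6i+5))]. *)
rewrite mul2n -addnn big_split_ord /=.
have -> : \prod_(i < n) ('X^(6 * n - 1) + - 1 * 'X^6 ^+ (n + i)) =
    'X^((6 * n - 1) * n) * qpoch_part 'X 'X^6 n :> {poly int}.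
  rewrite exprM prodc -big_split.
  apply: eq_bigr => i _ /=; rewrite -!exprM -exprS mulrBr mulr1 -exprD mulN1r.
  by congr (_ - 'X^_); have := ltn_ord i; lia.
rewrite (reindex_inj rev_ord_inj) /=.
have -> : \prod_(i < n) ('X^(6 * n - 1) + - 1 * 'X^6 ^+ (n - i.+1)) =
    (-1) ^+ n * 'X^(6 * 'C(n, 2)) * qpoch_part 'X^5 'X^6 n :> {poly int}.
  rewrite -bin2_sum big_mkord.
  rewrite (_ : \sum_(i < n) i = \sum_(i < n) (n - i.+1))%N; last first.
    by rewrite (reindex_inj rev_ord_inj).
  rewrite big_distrr /= prodc expr_sum -!big_split; apply: eq_bigr => i _ /=.
  rewrite -!exprM.
  have -> : (6 * n - 1 = 6 * (n - i.+1) + (5 + 6 * i))%N.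
    by have := ltn_ord i; lia.
  by rewrite !exprD; ring.
by rewrite exprD; ring.
Qed.

Lemma eqmX_sum c K (I : Type) (r : seq I) (F G : I -> {poly int}) :
  (forall i, eqmX c K (F i) (G i)) ->
  eqmX c K (\sum_(i <- r) F i) (\sum_(i <- r) G i).
Proof.
move=> eFG; elim: r => [|x r IHr]; first by rewrite !big_nil; apply: eqmX_refl.
by rewrite !big_cons; apply: eqmXD.
Qed.

(** Expand the product of [qprod_split] by [qbin_prod] and cancel the common power ['X^E].
    Multiplication by [qfact 'X^6 n] turns the k-th Gaussian binomial into 1 up to an error of order
    [6 * a.+1], and the terms in which this order is low carry a high power ['X^(jexp n k)]. *)
Lemma jacobi_triple n :
  eqmX 0 (6 * n)
    (qpoch_part 'X 'X^6 n * qpoch_part 'X^5 'X^6 n * qpoch_part 'X^6 'X^6 n)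
    (theta (iota 0 (2 * n).+1) (fun k => (-1) ^+ (k + n)) (jexp n)).
Proof.
have -> : qpoch_part 'X^6 'X^6 n = qfact 'X^6 n.
  by rewrite /qpoch_part /qfact; apply: eq_bigr => i _; rewrite -exprS.
set E := (6 * 'C(n, 2) + (6 * n - 1) * n)%N.
apply: (@eqmX_mulXnl _ _ E).
set D := qpoch_part 'X 'X^6 n * _.
have -> : 'X^E * (D * qfact 'X^6 n) =
    (-1) ^+ n * \prod_(k < 2 * n) ('X^(6 * n - 1) + - 1 * 'X^6 ^+ k)
      * qfact 'X^6 n.
  rewrite qprod_split -/D -/E mulrA mulrA mulrA -exprD addnn -mul2n exprM.
  by rewrite sqrrN expr1n expr1n mul1r.
have -> : iota 0 (2 * n).+1 = index_iota 0 (2 * n).+1 by rewrite /index_iota subn0.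
rewrite qbin_prod /theta big_mkord.
rewrite !mulr_sumr mulr_suml; apply: eqmX_sum => -[k /= kn].
pose a := minn k (2 * n - k).
have [||| u [v euv]] := @qbin_eqmX n k a; rewrite /a; [lia..|].
rewrite polyC0 mul0r addr0 in euv.
have je : (6 * n <= jexp n k + 6 * a.+1)%N.
  rewrite -lez_nat !PoszD jexpZ; set j := k%:Z - n%:Z.
  have aj : a%:Z = n%:Z - `|j| by rewrite /a /j; lia.
  (* The claim reduces to [3 j^2 - 8 |j| + 6 >= 0], and three times the left side is
     [(3 |j| - 4)^2 + 2]. *)
  have : 0 <= (3 * `|j| - 4) ^+ 2 by apply: sqr_ge0.
  have : j ^+ 2 = `|j| ^+ 2 by rewrite real_normK ?num_real.
  have : j <= `|j| by apply: ler_norm.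
  by rewrite !expr2; lia.
pose d := (jexp n k + 6 * a.+1 - 6 * n)%N.
have jd : 'X^(jexp n k) * 'X^(6 * a.+1) = 'X^(6 * n) * 'X^d :> {poly int}.
  by rewrite -!exprD /d subnKC.
exists 0, ((-1) ^+ (k + n) * 'X^d * v).
have -> : (-1) ^+ n * ('X^6 ^+ 'C(k, 2) * qbin 'X^6 (2 * n) k * (- 1) ^+ k *
    'X^(6 * n - 1) ^+ (2 * n - k)) * qfact 'X^6 n =
    (-1) ^+ (k + n) * 'X^(6 * 'C(k, 2) + (6 * n - 1) * (2 * n - k)) *
    (qfact 'X^6 n * qbin 'X^6 (2 * n) k) :> {poly int}.
  rewrite (exprD _ k) (exprD _ (6 * _)) !exprM; set Q := 'X^6; set y := 'X^(6 * n - 1).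
  move: (Q ^+ _) (y ^+ _) (qbin _ _ _) (qfact _ _) ((-1) ^+ n) ((-1) ^+ k).
  by move=> *; ring.
rewrite jexpE // -/E euv polyC_exp polyCN polyC0 (exprD _ E) (exprD _ E).
have -> : 'X^E * 'X^(6 * n) * ((-1) ^+ (k + n) * 'X^d * v) =
    'X^E * (-1) ^+ (k + n) * ('X^(6 * n) * 'X^d) * v :> {poly int} by ring.
by rewrite -jd; ring.
Qed.

(** * From the generating function to the relation [s psi = q] *)

Definition fps_trunc (K : nat) (f : fps) : {poly int} := \poly_(i < K) f i.

Lemma fps_trunc_mul K f g :
  eqmX 0 K (fps_trunc K (fps_mul f g)) (fps_trunc K f * fps_trunc K g).
Proof.
apply: eqmX_coefP => i iK; rewrite coef_poly iK coefM; apply: eq_bigr => j _.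
by rewrite !coef_poly !ifT //; have := ltn_ord j; lia.
Qed.

Lemma fps_trunc_qpoch K (a q : {poly int}) : q`_0 = 0 ->
  exists N0, forall N, (N0 <= N)%N ->
    eqmX 0 K (fps_trunc K (qpoch a q)) (qpoch_part a q N).
Proof.
move=> q0; have [N0 N0P] : exists N0, forall N, (N0 <= N)%N ->
    forall i, (i < K)%N -> (qpoch_part a q N)`_i = qpoch a q i.
  elim: K => [|K [N1 N1P]]; first by exists 0%N.
  have [N2 N2P] := qpoch_cvg a q0 K.
  exists (maxn N1 N2) => N; rewrite geq_max => /andP[N1N N2N] i.
  by rewrite ltnS leq_eqVlt => /predU1P[->|]; [apply: N2P | apply: N1P].
exists N0 => N NN; apply: eqmX_coefP => i iK.
by rewrite coef_poly iK (N0P N NN).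
Qed.

Lemma schurS_jacobi K : exists2 n, (K <= n)%N &
  eqmX 0 K
    (fps_trunc K schurS *
     theta (iota 0 (2 * n).+1) (fun k => (-1) ^+ (k + n)) (jexp n)) 1.
Proof.
have X60 : ('X^6 : {poly int})`_0 = 0 by rewrite coefXn.
have [N1 N1P] := fps_trunc_qpoch K 'X X60.
have [N2 N2P] := fps_trunc_qpoch K 'X^5 X60.
have [N3 N3P] := fps_trunc_qpoch K 'X^6 X60.
pose n := (K + N1 + N2 + N3)%N; exists n; first by rewrite /n; lia.
have {}N1P := N1P n ltac:(rewrite /n; lia).
have {}N2P := N2P n ltac:(rewrite /n; lia).
have {}N3P := N3P n ltac:(rewrite /n; lia).
have jt := eqmX_le (_ : (K <= 6 * n)%N) (jacobi_triple n).
have {}jt := jt ltac:(rewrite /n; lia).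
have tr1 : eqmX 0 K (fps_trunc K fps1) 1.
  by apply: eqmX_coefP => i iK; rewrite coef_poly iK coef1.
have trS : eqmX 0 K (fps_trunc K fps1) (fps_trunc K (fps_mul (fps_mul (fps_mul
    (qpoch 'X 'X^6) (qpoch 'X^5 'X^6)) (qpoch 'X^6 'X^6)) schurS)).
  by apply: eqmX_coefP => i iK; rewrite !coef_poly iK schurSP.
have {}trS := eqmX_trans trS (fps_trunc_mul _ _ _).
apply: eqmX_sym; apply: eqmX_trans (eqmX_sym tr1) _.
apply: eqmX_trans trS _; rewrite mulrC; apply: eqmXM; first exact: eqmX_refl.
apply: eqmX_trans jt; apply: eqmX_trans (fps_trunc_mul _ _ _) _; apply: eqmXM => //.
by apply: eqmX_trans (fps_trunc_mul _ _ _) _; apply: eqmXM.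
Qed.

(** Substitute [m = 1 - 3 j] with [j = k - n]: then [m^2 = 3 (3 j^2 - 2 j) + 1], and [m] is odd
    exactly when [j] is even. The summand 1 in the exponent is the ['X] on the right. *)
Lemma schurS_theta K :
  eqmX 0 K ((fps_trunc K schurS \Po 'X^3) * theta (zres K 1) (fun m => - sgn m) sq) 'X.
Proof.
have [n Kn en] := schurS_jacobi K.
have {}en := eqmX_le (_ : (K <= 3 * K)%N) (eqmX_comp_Xn 3 en).
have {}en := en ltac:(lia); rewrite comp_polyM comp_polyC theta_comp_Xn in en.
set L := iota _ _ in en; set sn := (fun k => (-1) ^+ _) in en.
have e2 : eqmX 0 K (theta L sn (fun k => (3 * jexp n k).+1))
    (theta (zres K 1) (fun m => - sgn m) sq).
  apply: (@theta_reindex _ _ _ _ _ _ (fun k : nat => 1 - 3 * (k%:Z - n%:Z))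
    (fun m : int => absz (n%:Z + ((1 - m) %/ 3)%Z)%R)).
  - exact: iota_uniq.
  - exact: uniq_zres.
  - move=> k; rewrite mem_iota => /andP[_ kn] wK.
    have sqk : sq (1 - 3 * (k%:Z - n%:Z)) = (3 * jexp n k).+1.
      apply/eqP; rewrite -eqz_nat sqE intS PoszM jexpZ; apply/eqP; ring.
    split=> //.
    + rewrite mem_zres; apply/andP; split; first by apply/eqP; lia.
      by apply: (@sq_le _ _ 0%N); rewrite addn0 sqk.
    + rewrite /sn /sgn -signr_odd.
      by case: eqP => e; case o: (odd (k + n)) => //; lia.
    + by lia.
  - move=> m; rewrite mem_zres => /andP[/eqP m3 _] mK.
    have mK' : (`|m| <= K)%N by apply: (@sq_le _ _ 0%N); rewrite addn0.
    set k := absz _.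
    have km : 1 - 3 * (k%:Z - n%:Z) = m by rewrite /k; lia.
    split=> //; first by rewrite mem_iota; lia.
    apply/eqP; rewrite -eqz_nat -km sqE intS PoszM jexpZ.
    by apply/eqP; ring.
apply: eqmX_trans (eqmXM (eqmX_refl _ _ _) (eqmX_sym e2)) _.
have -> : theta L sn (fun k => (3 * jexp n k).+1) =
    'X * theta L sn (fun k => (3 * jexp n k)%N).
  by rewrite /theta mulr_sumr; apply: eq_bigr => k _; rewrite exprS; ring.
rewrite mulrCA -[X in eqmX _ _ _ X]mulr1; apply: eqmXM en; exact: eqmX_refl.
Qed.

(** * Dilation by 4, and the fourth power of [Phi] mod 8 *)

(** The map [m -> - 2 * m] multiplies squares by 4 and, as -2 is 1 mod 3, keeps the class [r]; its
    image is the even part of that class. *)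
Lemma theta_dilate K r (s s' : int -> int) : r = 0 \/ r = 1 ->
  (forall m, s' (- 2 * m) = s m) ->
  eqmX 0 K (theta (zres K r) s sq \Po 'X^4) (theta (zpar K r 0) s' sq).
Proof.
move=> hr ss'; rewrite theta_comp_Xn.
have sq2 m : sq (- 2 * m) = (4 * sq m)%N.
  by apply/eqP; rewrite -eqz_nat PoszM !sqE; apply/eqP; ring.
apply: (@theta_reindex _ _ _ _ _ _ (fun m : int => - 2 * m)
  (fun m : int => ((- m) %/ 2)%Z)).
- exact: uniq_zres.
- exact: uniq_zpar.
- move=> m; rewrite mem_zres => /andP[/eqP m3 _] mK; split=> //; last by lia.
  rewrite mem_zpar; apply/and3P; split; try (apply/eqP; lia).
  by apply: (@sq_le _ _ 0%N); rewrite addn0 sq2.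
- move=> m; rewrite mem_zpar => /and3P[/eqP m2 /eqP m3 _] mK.
  have mK' : (`|m| <= K)%N by apply: (@sq_le _ _ 0%N); rewrite addn0.
  have m2' : - 2 * ((- m) %/ 2)%Z = m by lia.
  by split=> //; [rewrite mem_zres; lia | rewrite -sq2 m2'].
Qed.

(** Terms at [m] and [- m] coincide, and [m = 0] contributes 1. *)
Lemma theta_sgn_pm1 K : exists t, eqmX 0 K (theta (zres K 0) sgn sq) (1 + 2 * t).
Proof.
rewrite (theta_filter _ (fun m : int => 0 < m)); set t := theta _ _ _; exists t.
rewrite [X in _ + X](theta_filter _ (fun m : int => m < 0)).
have e1 : eqmX 0 K (theta (filter (fun m : int => m < 0)
    (filter (predC (fun m : int => 0 < m)) (zres K 0))) sgn sq) t.
  apply: (@theta_reindex _ _ _ _ _ _ (fun m : int => - m) (fun m : int => - m)).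
  - exact/filter_uniq/filter_uniq/uniq_zres.
  - exact/filter_uniq/uniq_zres.
  - move=> m; rewrite !mem_filter !mem_zrange /= => mL _; split.
    + by lia.
    + by rewrite /sq abszN.
    + by rewrite /sgn; do 2![case: eqP => ?] => //; lia.
    + exact: opprK.
  - move=> m; rewrite !mem_filter !mem_zrange /= => mL _; split.
    + by lia.
    + by rewrite /sq abszN.
    + exact: opprK.
have e2 : eqmX 0 K (theta (filter (predC (fun m : int => m < 0))
    (filter (predC (fun m : int => 0 < m)) (zres K 0))) sgn sq)
    (theta [:: 0] sgn sq).
  apply: (@theta_reindex _ _ _ _ _ _ id id) => //.
  - exact/filter_uniq/filter_uniq/uniq_zres.
  - move=> m; rewrite !mem_filter !mem_zrange /= => mL _; split=> //.
    by rewrite inE; lia.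
  - move=> m; rewrite inE => /eqP-> _; split=> //.
    by rewrite !mem_filter !mem_zrange.
have {}e2 : eqmX 0 K (theta (filter (predC (fun m : int => m < 0))
    (filter (predC (fun m : int => 0 < m)) (zres K 0))) sgn sq) 1.
  by apply: eqmX_trans e2 _; apply: eqmX_eq; rewrite /theta big_seq1 expr0 mulr1.
apply: eqmX_trans (eqmXD (eqmX_refl _ _ _) (eqmXD e1 e2)) _.
by apply: eqmX_eq; ring.
Qed.

Lemma theta_sgn_pow4 K : eqmX 8 K (theta (zres K 0) sgn sq ^+ 4) 1.
Proof.
have [t /(eqmX_weak 8)/(eqmXX 4) e] := theta_sgn_pm1 K.
(* The witness is [((1 + 2 t)^4 - 1) / 8]. *)
apply: eqmX_trans e _; exists (t + 3 * t ^+ 2 + 4 * t ^+ 3 + 2 * t ^+ 4), 0.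
have -> : 8%:P = 8 :> {poly int} by rewrite polyC_natr.
by ring.
Qed.

(** * Sections of series by exponent mod 4 *)

Definition supp4 (r : nat) (p : {poly int}) : Prop :=
  forall i, (i %% 4 != r)%N -> p`_i = 0.

Lemma supp4M r r' p q :
  supp4 r p -> supp4 r' q -> supp4 ((r + r') %% 4) (p * q).
Proof.
move=> sp sq i ir; rewrite coefM big1 // => j _.
have [ej|nj] := eqVneq (j %% 4)%N r; last by rewrite sp ?mul0r.
rewrite sq ?mulr0 //; apply: contraNneq ir => e.
by apply/eqP; have := ltn_ord j; lia.
Qed.

Lemma supp4_theta (I : eqType) (L : seq I) s w r :
  {in L, forall x, (w x %% 4)%N = r} -> supp4 r (theta L s w).
Proof.
move=> wr i ir; rewrite coef_theta big_seq_cond big1 // => x /andP[xL /eqP wi].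
by move: ir; rewrite -wi wr ?eqxx.
Qed.

Lemma supp4_odd K r : supp4 1 (theta (zpar K r 1) (fun=> 1) sq).
Proof.
apply: supp4_theta => m; rewrite mem_zpar => /andP[/eqP m2 _].
have [k ->] : exists k, m = 2 * k + 1 by exists (m %/ 2)%Z; lia.
by apply/eqP; rewrite -eqz_nat -modz_nat sqE expr2; nia.
Qed.

Lemma supp4_even K r : supp4 0 (theta (zpar K r 0) (fun=> 1) sq).
Proof.
apply: supp4_theta => m; rewrite mem_zpar => /andP[/eqP m2 _].
have [k ->] : exists k, m = 2 * k by exists (m %/ 2)%Z; lia.
by apply/eqP; rewrite -eqz_nat -modz_nat sqE expr2; nia.
Qed.

Lemma theta_zres_split K r s (x y : int) :
  (forall m, s m = if (m %% 2)%Z == 0 then x else y) ->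
  theta (zres K r) s sq =
  x%:P * theta (zpar K r 0) (fun=> 1) sq + y%:P * theta (zpar K r 1) (fun=> 1) sq.
Proof.
move=> sE; rewrite (theta_filter _ (fun m : int => (m %% 2)%Z == 0)).
have scal c L : theta L (fun=> c) sq = c%:P * theta L (fun=> 1) sq.
  by rewrite /theta mulr_sumr; apply: eq_bigr => m _; rewrite polyC1 mul1r.
congr (_ + _); rewrite -scal.
  by apply: eq_in_theta => m; rewrite mem_filter => /andP[m2 _]; rewrite sE m2.
rewrite (eq_in_filter (a2 := fun m : int => (m %% 2)%Z == 1)); last first.
  by move=> m _ /=; lia.
apply: eq_in_theta => m; rewrite mem_filter => /andP[/eqP m2 _].
by rewrite sE m2.
Qed.

(** Taking the exponents 1 mod 4 is linear over series in ['X^4]: only the coefficients of [s] at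
    [4 * j + 1] meet those of [p] at [i - j]. *)
Lemma eqmX_section K K' (s p q : {poly int}) : (4 * K' <= K)%N ->
  eqmX 0 K (s * (p \Po 'X^4)) q ->
  eqmX 0 K' (\poly_(i < K') s`_(4 * i + 1) * p) (\poly_(i < K') q`_(4 * i + 1)).
Proof.
move=> KK' e; apply: eqmX_coefP => i iK; rewrite coef_poly iK.
rewrite -(eqmX0_coef e); last by lia.
rewrite !coefM [RHS](eq_bigr (fun j : 'I_(4 * i + 1).+1 =>
   if (4 %| 4 * i + 1 - j)%N then s`_j * p`_((4 * i + 1 - j) %/ 4) else 0)); last first.
  move=> j _; rewrite coef_comp_poly_Xn //; case: ifP => // _; exact: mulr0.
rewrite -big_mkcond /=.
(* The indices that survive the divisibility test are the numbers [4 * j + 1] with [j <= i]. *)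
rewrite (reindex_onto (fun j : 'I_i.+1 => inord (4 * j + 1) : 'I_(4 * i + 1).+1)
  (fun j => inord (j %/ 4))) /=; last first.
  move=> j dj; apply: val_inj => /=; have := ltn_ord j => jl.
  rewrite inordK; last by rewrite inordK; lia.
  by rewrite inordK; lia.
apply: eq_big => [j|j _].
  have jl := ltn_ord j.
  have e1 : (inord (4 * j + 1) : 'I_(4 * i + 1).+1) = (4 * j + 1)%N :> nat.
    by rewrite inordK //; lia.
  rewrite e1; apply/esym/andP; split; first by lia.
  by apply/eqP/val_inj; rewrite /= inordK; lia.
have jl := ltn_ord j.
rewrite coef_poly ifT; last by lia.
by rewrite inordK; [congr (_ * _`_ _); lia | lia].
Qed.

(** The first two are truncations of [A] and [B]. With the last two, [Bev + Bodd] truncates [F] and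
    [Bev - Bodd] truncates [Phi]. *)
Local Notation Aodd K := (theta (zpar K 1 1) (fun=> 1) sq).
Local Notation Aev K := (theta (zpar K 1 0) (fun=> 1) sq).
Local Notation Bodd K := (theta (zpar K 0 1) (fun=> 1) sq).
Local Notation Bev K := (theta (zpar K 0 0) (fun=> 1) sq).

(** Division by [psi] is replaced by the relation [s psi = q], which is why both sides keep a factor
    ['X]. *)
Lemma schurS_section K K' : (4 * K' <= K)%N ->
  eqmX 8 K'
    ('X * \poly_(i < K') (fps_trunc K schurS \Po 'X^3)`_(4 * i + 1))
    ('X * ((Bev K - Bodd K) * (Aodd K ^+ 2 + 4 * Aodd K * Aev K + 7 * Aev K ^+ 2))).
Proof.
move=> KK'; set s := fps_trunc K schurS \Po 'X^3; set u := \poly_(i < K') _.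
set a := Aodd K; set b := Aev K; set c := Bodd K; set d := Bev K.
have compX (p : {poly int}) n : (p ^+ n) \Po 'X^4 = (p \Po 'X^4) ^+ n.
  by elim: n => [|n IHn]; rewrite ?expr0 ?comp_polyC // (exprS p) comp_polyM IHn -exprS.
have C1 : (1 : int)%:P = 1 by [].
have psiE : theta (zres K 1) (fun m => - sgn m) sq = a - b.
  rewrite (@theta_zres_split K 1 _ (-1) 1) ?polyCN ?C1;
    first by rewrite -/a -/b -/c -/d; ring.
  by move=> m; rewrite /sgn; case: ifP.
have PE : theta (zres K 1) (fun=> 1) sq = a + b.
  rewrite (@theta_zres_split K 1 _ 1 1) ?C1;
    first by rewrite -/a -/b -/c -/d; ring.
  by move=> m; case: ifP.
have PhiE : theta (zres K 0) sgn sq = d - c.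
  rewrite (@theta_zres_split K 0 _ 1 (-1)) ?polyCN ?C1;
    first by rewrite -/a -/b -/c -/d; ring.
  by move=> m; rewrite /sgn; case: ifP.
have spsi := schurS_theta K; rewrite -/s psiE in spsi.
have spsi4 := eqmX_le (_ : (K <= 4 * K)%N) (eqmX_comp_Xn 4 spsi).
have {}spsi4 := spsi4 ltac:(lia); rewrite comp_polyM comp_polyX in spsi4.
have sg2 m : sgn4 (- 2 * m) = sgn m.
  by rewrite /sgn4 /sgn; do 2![case: eqP => ?] => //; lia.
have psi4 : eqmX 0 K ((a - b) \Po 'X^4) (theta (zpar K 1 0) (fun m => - sgn4 m) sq).
  by rewrite -psiE; apply: theta_dilate; [right | move=> m; rewrite sg2].
have Phi4 : eqmX 0 K ((d - c) \Po 'X^4) (theta (zpar K 0 0) sgn4 sq).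
  by rewrite -PhiE; apply: theta_dilate; [left | move=> m; rewrite sg2].
have P4 : eqmX 0 K ((a + b) \Po 'X^4) b.
  by rewrite -PE; apply: theta_dilate; [right | ].
have quart : eqmX 0 K (a ^+ 4 - b ^+ 4)
    (((a - b) \Po 'X^4) * ((d - c) \Po 'X^4) ^+ 3).
  apply: eqmX_trans (theta_quartic K) _; apply: eqmX_sym.
  by apply: eqmXM => //; apply: eqmXX.
(* [T] is the cofactor in [a^4 - b^4 = (a - b) T]. *)
pose T := a ^+ 3 + a ^+ 2 * b + a * b ^+ 2 + b ^+ 3.
(* Insert [q^4 = s(q^4) psi(q^4)] on the left, apply the quartic identity, and use [s (a - b) = q]
   on one factor of [a^4 - b^4]. *)
have e1 : eqmX 0 K (s * (('X * (d - c) ^+ 3) \Po 'X^4)) ('X * T * (s \Po 'X^4)).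
  rewrite comp_polyM comp_polyX compX.
  have h1 := eqmXM spsi4 (eqmX_refl 0 K (s * ((d - c) \Po 'X^4) ^+ 3)).
  have h2 := eqmXM quart (eqmX_refl 0 K (s * (s \Po 'X^4))).
  have h3 := eqmXM spsi (eqmX_refl 0 K (T * (s \Po 'X^4))).
  have -> : s * ('X^4 * ((d - c) \Po 'X^4) ^+ 3) =
    'X^4 * (s * ((d - c) \Po 'X^4) ^+ 3) by ring.
  apply: eqmX_trans (eqmX_sym h1) _.
  have -> : 'X * T * (s \Po 'X^4) = 'X * (T * (s \Po 'X^4)) by ring.
  apply: eqmX_trans h3.
  have -> : s * (a - b) * (T * (s \Po 'X^4)) =
     (a ^+ 4 - b ^+ 4) * (s * (s \Po 'X^4)) by rewrite /T; ring.
  apply: eqmX_sym; apply: eqmX_trans h2 _; apply: eqmX_eq; ring.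
have := eqmX_section KK' e1; rewrite -/u => e2.
(* After the shift by ['X], the terms with [a^3], [a^2 b] and [a b^2] have exponents 0, 3 and 2 mod
   4. Only [b^3] contributes, and [b] is [a + b] dilated by 4. *)
have e3 : eqmX 0 K' (\poly_(i < K') ('X * T * (s \Po 'X^4))`_(4 * i + 1))
    (s * (a + b) ^+ 3).
  apply: eqmX_coefP => i iK; rewrite coef_poly iK.
  have -> : 'X * T * (s \Po 'X^4) = 'X * (b ^+ 3 * (s \Po 'X^4)) +
    'X * (a * a * a * (s \Po 'X^4) + a * a * b * (s \Po 'X^4)
       + a * b * b * (s \Po 'X^4)) by rewrite /T; ring.
  have sa : supp4 1 a := supp4_odd K 1.
  have sb : supp4 0 b := supp4_even K 1.
  have ss : supp4 0 (s \Po 'X^4).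
    by move=> j j4; rewrite coef_comp_poly_Xn // ifF //; lia.
  rewrite coefD !coefXM addn1 /= [X in _ + X]coefD [X in _ + (X + _)]coefD.
  rewrite (supp4M (supp4M (supp4M sa sa) sa) ss) /=; last by rewrite modnMr.
  rewrite (supp4M (supp4M (supp4M sa sa) sb) ss) /=; last by rewrite modnMr.
  rewrite (supp4M (supp4M (supp4M sa sb) sb) ss) /=; last by rewrite modnMr.
  rewrite !addr0.
  have e4 := eqmXM (eqmXX 3 P4) (eqmX_refl 0 K (s \Po 'X^4)).
  rewrite -(eqmX0_coef e4); last by lia.
  rewrite -compX -comp_polyM coef_comp_poly_Xn // dvdn_mulr // mulKn //.
  by rewrite mulrC.
have {e2 e3} e3 := eqmX_weak 8 (eqmX_trans e2 e3).
have spsi' := eqmX_weak 8 (eqmX_le (_ : (K' <= K)%N) spsi).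
have {}spsi' := spsi' ltac:(lia).
have Phi8 := eqmX_le (_ : (K' <= K)%N) (theta_sgn_pow4 K).
have {}Phi8 := Phi8 ltac:(lia); rewrite PhiE in Phi8.
(* Multiplying by the fourth power of [d - c], which is 1 mod 8, supplies the cube required by [e3]
   and leaves one factor [d - c]. *)
have h1 := eqmXM (eqmX_refl 8 K' ('X * u)) (eqmX_sym Phi8).
rewrite mulr1 in h1; apply: eqmX_trans h1 _.
have -> : 'X * u * (d - c) ^+ 4 = (u * ('X * (d - c) ^+ 3)) * (d - c) by ring.
apply: eqmX_trans (eqmXM e3 (eqmX_refl _ _ _)) _.
have h2 := eqmXM spsi' (eqmX_refl 8 K'
  ((d - c) * (a ^+ 2 + 4 * a * b + 7 * b ^+ 2))).
apply: eqmX_trans h2.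
(* Indeed [(a + b)^3 - (a - b) (a^2 + 4 a b + 7 b^2) = 8 b^3]. *)
exists (s * (d - c) * b ^+ 3), 0.
have -> : 8%:P = 8 :> {poly int} by rewrite polyC_natr.
by ring.
Qed.

(** * Comparison of coefficients and the two congruences *)

Definition schurR (K : nat) : {poly int} :=
  (Bev K - Bodd K) * (Aodd K ^+ 2 + 4 * Aodd K * Aev K + 7 * Aev K ^+ 2).

Definition schurW (K : nat) : {poly int} :=
  (Bev K + Bodd K) * (Aodd K + Aev K) ^+ 2.

Lemma schurS_coef K N m : (3 * m = 4 * N + 1)%N -> (4 * N + 8 <= K)%N ->
  exists z, schurS m = (schurR K)`_N + 8 * z.
Proof.
move=> mN NK; have := @schurS_section K N.+2; rewrite -/(schurR K).
case/(_ _)/(eqmX_mulXnl (n := 1) (K := N.+1))/eqmX_coef/(_ (ltnSn N)); first lia.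
move=> z; rewrite coef_poly ltnS leqnSn coef_comp_poly_Xn // -mN.
rewrite dvdn_mulr // mulKn // coef_poly ifT; last by lia.
by move=> e; exists z.
Qed.

(** A product of three theta factors has exponents congruent mod 4 to the number of its odd factors.
    Residue 0 leaves only [d * b * b] and residue 3 only [c * a * a], whose coefficients in [schurR]
    and [schurW] are -1 and 1. *)
Lemma coef_even_odd K i :
  [/\ (i %% 4 = 0)%N -> (schurR K)`_i = 7 * (Bev K * Aev K ^+ 2)`_i,
      (i %% 4 = 0)%N -> (schurW K)`_i = (Bev K * Aev K ^+ 2)`_i &
      (i %% 4 = 3)%N -> (schurR K)`_i = - (schurW K)`_i].
Proof.
rewrite /schurR /schurW.
have sa : supp4 1 (Aodd K) := supp4_odd K 1.
have sb : supp4 0 (Aev K) := supp4_even K 1.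
have sc : supp4 1 (Bodd K) := supp4_odd K 0.
have sd : supp4 0 (Bev K) := supp4_even K 0.
set a := Aodd K in sa *; set b := Aev K in sb *.
set c := Bodd K in sc *; set d := Bev K in sd *.
have daa := supp4M (supp4M sd sa) sa; have dab := supp4M (supp4M sd sa) sb.
have dbb := supp4M (supp4M sd sb) sb; have caa := supp4M (supp4M sc sa) sa.
have cab := supp4M (supp4M sc sa) sb; have cbb := supp4M (supp4M sc sb) sb.
have -> : (d - c) * (a ^+ 2 + 4 * a * b + 7 * b ^+ 2) =
  d * a * a + (d * a * b) *+ 4 + (d * b * b) *+ 7
  - c * a * a - (c * a * b) *+ 4 - (c * b * b) *+ 7 by ring.
have -> : (d + c) * (a + b) ^+ 2 =
  d * a * a + (d * a * b) *+ 2 + d * b * b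
  + c * a * a + (c * a * b) *+ 2 + c * b * b by ring.
have -> : d * b ^+ 2 = d * b * b by ring.
rewrite !(coefD, coefN, coefMn); split=> i4.
- by rewrite daa ?dab ?caa ?cab ?cbb ?i4 //; ring.
- by rewrite daa ?dab ?caa ?cab ?cbb ?i4 //; ring.
- by rewrite daa ?dab ?dbb ?cab ?cbb ?i4 //; ring.
Qed.

(** [Bev] and [Aev] are the dilations by 4 of [F] and [P], so the product on the left is [schurW]
    dilated by 4. *)
Lemma schurW_dilate K M : (4 * M < K)%N ->
  (Bev K * Aev K ^+ 2)`_(4 * M) = (schurW K)`_M.
Proof.
move=> MK.
have PE : theta (zres K 1) (fun=> 1) sq = Aodd K + Aev K.
  rewrite (@theta_zres_split K 1 _ 1 1) ?polyC1; first by ring.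
  by move=> m; case: ifP.
have FE : theta (zres K 0) (fun=> 1) sq = Bev K + Bodd K.
  rewrite (@theta_zres_split K 0 _ 1 1) ?polyC1; first by ring.
  by move=> m; case: ifP.
have P4 : eqmX 0 K ((Aodd K + Aev K) \Po 'X^4) (Aev K).
  by rewrite -PE; apply: theta_dilate; [right | ].
have F4 : eqmX 0 K ((Bev K + Bodd K) \Po 'X^4) (Bev K).
  by rewrite -FE; apply: theta_dilate; [left | ].
rewrite -(eqmX0_coef (eqmXM F4 (eqmXX 2 P4)) MK) (expr2 (_ \Po _)).
by rewrite -!comp_polyM coef_comp_poly_Xn // dvdn_mulr // mulKn.
Qed.

Theorem theorem5p1 (n : nat) :
  (schurS (64 * n + 43)%N = schurS (16 * n + 11)%N %[mod 8])%Z /\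
  (schurS (64 * n + 59)%N = schurS (16 * n + 15)%N %[mod 8])%Z.
Proof.
pose K := (192 * n + 200)%N.
(* This is [schurS_coef] at [N = 4 * M], an index in residue class 0. *)
have S16 m M : (3 * m = 16 * M + 1)%N -> (16 * M + 8 <= K)%N ->
    exists z, schurS m = 7 * (schurW K)`_M + 8 * z.
  move=> mM MK; have [||z ->] := @schurS_coef K (4 * M) m; [lia..|].
  have [R4 _ _] := coef_even_odd K (4 * M); rewrite R4 ?modnMr //.
  by exists z; rewrite schurW_dilate //; lia.
have even_W M : (4 * M < K)%N -> (schurW K)`_(4 * M) = (schurW K)`_M.
  move=> MK; rewrite -(schurW_dilate MK).
  by have [_ + _] := coef_even_odd K (4 * M); apply; apply: modnMr.
have leK M : (M <= 12 * n + 11)%N -> (16 * M + 8 <= K)%N by rewrite /K; lia.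
split.
- have [||z1 ->] := S16 (64 * n + 43)%N (4 * (3 * n + 2))%N; [lia | apply: leK; lia |].
  have [||z2 ->] := S16 (16 * n + 11)%N (3 * n + 2)%N; [lia | apply: leK; lia |].
  by rewrite even_W; [lia | rewrite /K; lia].
- have [||z1 ->] := S16 (64 * n + 59)%N (12 * n + 11)%N; [lia | exact: leK |].
  (* Here [3 (16 n + 15) = 4 (12 n + 11) + 1] and [12 n + 11] is 3 mod 4, so the value is minus the
     coefficient of [schurW]; this agrees with the 7 above since [7 = -1] mod 8. *)
  have [||z2 ->] := @schurS_coef K (12 * n + 11) (16 * n + 15); [lia | rewrite /K; lia |].
  have [_ _ R3] := coef_even_odd K (12 * n + 11); rewrite R3; lia.
Qed.
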